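(* Let $F/K$ be a finite Galois totally ramified extension of complete discrete valuation fields with residue characteristic $p>0$ and $G=\mathrm{Gal}(F/K)$. Let $\sigma\in G_1$ and $f\in F\setminus\{0\}$. If $v_F(f)$ is nonzero and prime to $p$, then $$v_F(\sigma(f)-f)=v_F(f)+i_G(\sigma).$$
   Context: $v_F$ is the normalized valuation of $F$ (with $v_F(0)=\infty$) and $\pi_F$ is a uniformizer. Totally ramified means that $[F:K]$ equals the ramification index. The ramification groups are $G_i=\{\sigma\in G: v_F(\sigma(\pi_F)-\pi_F)\ge i+1\}$ for $i\ge-1$. The function $i_G$ is normalized as $i_G(\sigma):=v_F\big((\sigma(\pi_F)-\pi_F)/\pi_F\big)$, so $i_G(1)=\infty$ and $\sigma\in G_i$ iff $i_G(\sigma)\ge i$. The fields may have characteristic $0$ or $p$. *)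

(* Defs.v *)
From HB Require Import structures.
From mathcomp Require Import all_boot all_order all_algebra all_fingroup all_field.
From mathcomp Require Import ring_quotient.
From mathcomp Require Export constructive_ereal.

Set Implicit Arguments.
Unset Strict Implicit.
Unset Printing Implicit Defensive.

Import Order.TTheory GRing.Theory Num.Theory.
Local Open Scope ring_scope.
Local Open Scope ereal_scope.

(* Normalized discrete valuations; the value group with infinity is a part of
   [\bar int], from which [-oo] is excluded.  Surjectivity onto the integers
   is equivalent to 1 being a value. *)
Record discrete_valuation (L : fieldType) := DiscreteValuation {
  dval :> L -> \bar int;
  dvalNy : forall x, dval x != -oo;
  dval_eqy : forall x, (dval x == +oo) = (x == 0%R);
  dvalM : forall x y, dval (x * y)%R = dval x + dval y;
  dvalD : forall x y, Order.min (dval x) (dval y) <= dval (x + y)%R;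
  dval_normalized : exists x, dval x = 1%:E
}.

Section Valuation.
Variables (L : fieldType) (v : discrete_valuation L).

Definition uniformizer (t : L) : Prop := v t = 1%:E.

Definition cauchy_for (u : nat -> L) : Prop :=
  forall N : int, exists n0, forall m n : nat,
    (n0 <= m)%N -> (n0 <= n)%N -> N%:E <= v (u m - u n)%R.

Definition converges_to (u : nat -> L) (l : L) : Prop :=
  forall N : int, exists n0, forall n : nat,
    (n0 <= n)%N -> N%:E <= v (u n - l)%R.

Definition complete_valuation : Prop :=
  forall u : nat -> L, cauchy_for u -> exists l, converges_to u l.

Lemma dval1 : v 1%R = 0.
Proof.
have := dvalM v 1%R 1%R; rewrite mulr1.
have := dvalNy v 1%R; have := dval_eqy v 1%R; rewrite oner_eq0.
case: (v 1%R) => [r| |] //= _ _ [] /eqP.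
by rewrite -subr_eq0 opprD addrA subrr sub0r oppr_eq0 => /eqP ->.
Qed.

Lemma dval0 : v 0%R = +oo.
Proof. by apply/eqP; rewrite dval_eqy. Qed.

Lemma dvalN x : v (- x)%R = v x.
Proof.
suff vN1 : v (- 1)%R = 0 by rewrite -mulN1r dvalM vN1 add0e.
have := dvalM v (-1)%R (-1)%R; rewrite mulrNN mulr1 dval1.
have := dvalNy v (-1)%R; have := dval_eqy v (-1)%R; rewrite oppr_eq0 oner_eq0.
case: (v (-1)%R) => [r| |] //= _ _ [] /esym/eqP.
by rewrite -mulr2n mulrn_eq0 /= => /eqP ->.
Qed.

Definition valring_pred : {pred L} := fun x => 0 <= v x.

Lemma valring_subring_closed : subring_closed valring_pred.
Proof.
split=> [|x y|x y]; rewrite !unfold_in /valring_pred ?dval1 // => vx vy.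
- apply: le_trans (dvalD v x (- y)%R).
  by rewrite dvalN le_min vx.
- by rewrite dvalM adde_ge0.
Qed.

HB.instance Definition _ :=
  GRing.isSubringClosed.Build L valring_pred valring_subring_closed.

Record valring := Valring { valring_val : L; _ : valring_pred valring_val }.

HB.instance Definition _ := [isSub for valring_val].
HB.instance Definition _ := [Choice of valring by <:].
HB.instance Definition _ := [SubChoice_isSubComNzRing of valring by <:].

Definition maximal_ideal : {pred valring} := fun x => 0 < v (\val x).

Lemma maximal_ideal_idealr_closed : idealr_closed maximal_ideal.
Proof.
split; rewrite ?unfold_in /maximal_ideal ?raddf0 ?rmorph1 ?dval0 ?dval1 //.
move=> a x y; rewrite !unfold_in /maximal_ideal /= => vx vy.
apply: lt_le_trans (dvalD v _ _); rewrite lt_min vy andbT dvalM.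
have va : 0 <= v (valring_val a) := valP a.
exact: lt_le_trans vx (leeDr _ va).
Qed.

HB.instance Definition _ :=
  isIdealr.Build valring maximal_ideal maximal_ideal_idealr_closed.

Definition residue_field := {ideal_quot maximal_ideal}.
HB.instance Definition _ := GRing.ComNzRing.on residue_field.

End Valuation.

Arguments valring_pred {L} v.
Arguments maximal_ideal {L} v.

Section Extension.
Variables (K : fieldType) (F : splittingFieldType K).
Variables (vK : discrete_valuation K) (vF : discrete_valuation F).

(* [vF] extends [vK] up to renormalization, with ramification index [e]. *)
Definition ramification_index (e : nat) : Prop :=
  (0 < e)%N /\ forall x : K, vF (x%:A)%R = vK x *+ e.

Definition totally_ramified : Prop := ramification_index (\dim {:F}).

Definition ramification_group (t : F) (i : int) : {set gal_of {:F}} :=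
  [set s in 'Gal({:F} / 1)%g | (i + 1)%:E <= vF (s t - t)%R].

Definition i_G (t : F) (s : gal_of {:F}) : \bar int := vF ((s t - t) / t)%R.

End Extension.

(* Main.v *)
(* Since [F / K] is totally ramified, the powers [1, t, ..., t ^ (e - 1)] of a
   uniformizer form a basis of [F] over [K], and the valuation of an element is
   the least valuation of its terms, whose valuations are distinct mod [e].
   Writing [s t = t u] with [v (u - 1) = i_G s >= 1], this gives
   [v (s x - x) > i_G s] for every unit [x] when [i_G s] is finite.  For
   [f = t ^ n x] with [x] a unit, [s f - f] is [t ^ n] times
   [(u ^ n - 1) (s x) + (s x - x)], and [v (u ^ n - 1) = v (u - 1)] because
   [(u ^ n - 1) / (u - 1)] is congruent to [n], which is invertible in the
   residue field.  A negative [n] reduces to [- n] by inverting [f]. *)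
Require Import Defs.
From mathcomp Require Import all_boot all_order all_algebra all_fingroup all_field.
From mathcomp Require Import zify ring.

Set Implicit Arguments.
Unset Strict Implicit.
Unset Printing Implicit Defensive.

Import Order.TTheory GRing.Theory Num.Theory.
Local Open Scope ring_scope.
Local Open Scope ereal_scope.

(** Reduction mod [d]; it separates the valuations of monomials with different powers of [t]. *)
Lemma modz_uniq (m n : int) (d i j : nat) :
  (m *+ d + i%:Z = n *+ d + j%:Z)%R -> (i < d)%N -> (j < d)%N -> i = j.
Proof.
rewrite -(mulr_natr m) -(mulr_natr n) natz => mn lt_id lt_jd.
have : modz (m * d%:Z + i%:Z)%R d%:Z = modz (n * d%:Z + j%:Z)%R d%:Z by rewrite mn.
by rewrite !modzMDl !modz_nat !modn_small // => -[].
Qed.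

(** * Arithmetic of a discrete valuation *)

Section DiscreteValuation.
Variables (L : fieldType) (v : discrete_valuation L).

Lemma dval_fin_num x : x != 0%R -> v x \is a fin_num.
Proof. by rewrite fin_numE dvalNy dval_eqy. Qed.

Lemma dvalX x n : v (x ^+ n)%R = v x *+ n.
Proof.
elim: n => [|n IHn]; first by rewrite expr0 dval1.
by rewrite exprS dvalM IHn muleS.
Qed.

Lemma dvalV x : x != 0%R -> v x^-1%R = - v x.
Proof.
move=> x0; have := dvalM v x x^-1%R; rewrite divff // dval1.
have := dval_fin_num x0; have: x^-1%R != 0%R by rewrite invr_eq0.
move=> /dval_fin_num /fineK <- /fineK <- [] /esym/eqP.
by rewrite addrC addr_eq0 => /eqP ->.
Qed.

(** Writing [y] as [(x + y) - x] bounds [v y] below by a minimum that [v x] cannot attain. *)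
Lemma dvalD_ltr x y : v y < v x -> v (x + y)%R = v y.
Proof.
move=> vyx; apply/le_anti; apply/andP; split; last first.
  by apply: le_trans (dvalD v x y); rewrite le_min lexx ltW.
have := dvalD v (x + y)%R (- x)%R.
by rewrite addrAC subrr add0r dvalN ge_min [v x <= _]leNgt vyx orbF.
Qed.

Lemma dval_sum_ge (I : Type) (r : seq I) (P : pred I) (g : I -> L) c :
  (forall i, P i -> c <= v (g i)) -> c <= v (\sum_(i <- r | P i) g i)%R.
Proof.
move=> cg; elim/big_ind: _ => // [|x y cx cy]; first by rewrite dval0 leey.
by apply: le_trans (dvalD v x y); rewrite le_min cx.
Qed.

Lemma dval_sum_gt (I : Type) (r : seq I) (P : pred I) (g : I -> L) c :
  c < +oo ->
  (forall i, P i -> c < v (g i)) -> c < v (\sum_(i <- r | P i) g i)%R.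
Proof.
move=> cy cg; elim/big_ind: _ => // [|x y cx cy']; first by rewrite dval0.
by apply: lt_le_trans (dvalD v x y); rewrite lt_min cx.
Qed.

(** A nonzero term of least valuation lies strictly below all others, so it fixes the valuation of
    the sum. Zero terms may repeat, which allows for vanishing coefficients. *)
Lemma dval_sum_distinct (I : finType) (g : I -> L) :
  (forall i j, g i != 0%R -> v (g i) = v (g j) -> i = j) ->
  forall i, v (\sum_j g j)%R <= v (g i).
Proof.
move=> g_inj i; case: (@arg_minP _ _ _ i xpredT (fun j => v (g j))) => //.
move=> k _ kmin.
apply: le_trans (kmin i isT); have [->|gk0] := eqVneq (g k) 0%R.
  by rewrite dval0 leey.
rewrite (bigD1 k) //= addrC dvalD_ltr //.
apply: dval_sum_gt => [|j jk]; first by rewrite ltey_eq dval_fin_num.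
rewrite lt_neqAle kmin // andbT; apply: contra jk => /eqP/(g_inj _ _ gk0) ->.
exact: eqxx.
Qed.

Lemma dval_nat_ge0 n : 0 <= v n%:R%R.
Proof.
elim: n => [|n IHn]; first by rewrite dval0 leey.
by rewrite mulrS; apply: le_trans (dvalD v _ _); rewrite le_min dval1 lexx.
Qed.

Lemma dval_residue_pchar p : p \in [pchar residue_field v] -> 0 < v p%:R%R.
Proof.
move=> /pcharf0; rewrite -(rmorph_nat (\pi_(residue_field v)%qT)).
rewrite -[X in _ = X](rmorph0 (\pi_(residue_field v)%qT)) => /eqP.
by rewrite -Quotient.idealrBE subr0 unfold_in /maximal_ideal (rmorph_nat val).
Qed.

(** By Bezout some multiple of [n] is [b * p + 1], of valuation 0; both of its factors have
    nonnegative valuation. *)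
Lemma dval_nat_coprime p n :
  p \in [pchar residue_field v] -> coprime n p -> v n%:R%R = 0.
Proof.
move=> pchar_p; have p_gt1 := prime_gt1 (pcharf_prime pchar_p).
case: n => [|n cop].
  by rewrite /coprime gcd0n => /eqP p1; rewrite p1 in p_gt1.
have [//|[a b] /= ab1] := coprimeP _ _ cop.
have {}ab1 : (a * n.+1 = b * p + 1)%N by lia.
have : v (a * n.+1)%:R%R = 0.
  rewrite ab1 natrD dvalD_ltr dval1 // natrM dvalM.
  exact: lte_paddl (dval_nat_ge0 b) (dval_residue_pchar pchar_p).
rewrite natrM dvalM => van; apply/le_anti; rewrite dval_nat_ge0 andbT -van.
by rewrite leeDr ?dval_nat_ge0.
Qed.

Lemma dval_ge0_sub1 x : 0 <= v (x - 1)%R -> 0 <= v x.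
Proof.
move=> x1; rewrite -[x](subrK 1%R); apply: le_trans (dvalD v _ _).
by rewrite le_min x1 dval1 lexx.
Qed.

Lemma dval_subX1_ge x n : 0 <= v (x - 1)%R -> v (x - 1)%R <= v (x ^+ n - 1)%R.
Proof.
move=> x1; rewrite subrX1 dvalM leeDl //; apply: dval_sum_ge => i _.
by rewrite dvalX -mule_natl mule_ge0 ?lee_fin ?ler0n // dval_ge0_sub1.
Qed.

(** The cofactor of [x - 1] is [n] plus a sum of terms [x ^+ i - 1] of positive valuation. *)
Lemma dval_subX1 x n :
  0 < v (x - 1)%R -> v n%:R%R = 0 -> v (x ^+ n - 1)%R = v (x - 1)%R.
Proof.
move=> x1 vn; rewrite subrX1 dvalM.
suff -> : v (\sum_(i < n) x ^+ i)%R = 0 by rewrite adde0.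
have -> : (\sum_(i < n) x ^+ i = \sum_(i < n) (x ^+ i - 1) + n%:R)%R.
  by rewrite sumrB sumr_const card_ord subrK.
rewrite dvalD_ltr vn //; apply: dval_sum_gt => // i _.
exact: lt_le_trans x1 (dval_subX1_ge _ (ltW x1)).
Qed.

End DiscreteValuation.

(** * Expansions in powers of a uniformizer and the action of [s] on them *)

Section TotallyRamified.
Variables (K : fieldType) (F : splittingFieldType K).
Variables (vK : discrete_valuation K) (vF : discrete_valuation F).
Hypothesis ramFK : totally_ramified vK vF.
Variable t : F.
Hypothesis unif_t : uniformizer vF t.

Let e := \dim {:F}.

Lemma uniformizer_neq0 : t != 0%R.
Proof. by rewrite -(dval_eqy vF) unif_t. Qed.

Lemma dval_uniformizerX n : vF (t ^+ n)%R = n%:Z%:E.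
Proof. by rewrite dvalX unif_t -EFin_natmul natz. Qed.

Lemma dval_monomial a n : vF (a *: t ^+ n)%R = vK a *+ e + n%:Z%:E.
Proof.
by rewrite -mulr_algl dvalM dval_uniformizerX; have [_ ->] := ramFK.
Qed.

Lemma dval_monomial_inj (a : 'I_e -> K) (i j : 'I_e) :
  (a i *: t ^+ i)%R != 0%R ->
  vF (a i *: t ^+ i)%R = vF (a j *: t ^+ j)%R -> i = j.
Proof.
move=> ai0 vij; have aj0 : (a j *: t ^+ j)%R != 0%R.
  by rewrite -(dval_eqy vF) -vij dval_eqy.
move: ai0 aj0 vij; rewrite !scaler_eq0 !negb_or !dval_monomial.
move=> /andP[ai0 _] /andP[aj0 _].
rewrite -(fineK (dval_fin_num vK ai0)) -(fineK (dval_fin_num vK aj0)).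
rewrite -!EFin_natmul -!EFinD => -[].
by move/modz_uniq => -/(_ (ltn_ord i) (ltn_ord j)) /val_inj.
Qed.

(** A vanishing combination has valuation [+oo], hence so has each of its terms: the powers are
    free, and there are as many as the dimension. *)
Lemma uniformizer_basis x : exists a : 'I_e -> K, x = (\sum_i a i *: t ^+ i)%R.
Proof.
pose X := [tuple (t ^+ i)%R | i < e].
have nthX (i : 'I_e) : (X`_i = t ^+ i)%R.
  by rewrite (nth_map i) ?size_enum_ord // nth_ord_enum.
have freeX : free X.
  apply/freeP => k; under eq_bigr do rewrite nthX.
  move=> k0 i; have := dval_sum_distinct (@dval_monomial_inj k) i.
  rewrite k0 dval0 leye_eq dval_eqy scaler_eq0 expf_eq0.
  by rewrite (negPf uniformizer_neq0) andbF orbF => /eqP.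
have basisX : basis_of {:F} X.
  by rewrite basisEfree freeX subvf size_tuple leqnn.
exists (coord X ^~ x); rewrite {1}(coord_basis basisX (memvf x)).
by apply: eq_bigr => i _; rewrite nthX.
Qed.

Lemma dval_monomial_ge (a : 'I_e -> K) i :
  vF (\sum_j a j *: t ^+ j)%R <= vF (a i *: t ^+ i)%R.
Proof. exact/dval_sum_distinct/dval_monomial_inj. Qed.

Variable s : gal_of {:F}.
Hypothesis sG1 : s \in ramification_group vF t 1.

Lemma i_G_sub1 : i_G vF t s = vF (s t / t - 1)%R.
Proof. by rewrite /i_G mulrBl divff // uniformizer_neq0. Qed.

(** Membership in the first ramification group means valuation at least 2 for [s t - t]; dividing by
    [t] lowers it by 1. *)
Lemma i_G_ge1 : 1%:E <= i_G vF t s.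
Proof.
move: sG1; rewrite inE => /andP[_].
rewrite /i_G dvalM dvalV ?uniformizer_neq0 // unif_t.
by case: (vF _) => [r| |] //=; rewrite !lee_fin; lia.
Qed.

Lemma i_G_gt0 : 0 < i_G vF t s.
Proof. exact: lt_le_trans i_G_ge1. Qed.

Lemma gal_monomial_sub a n :
  (s (a *: t ^+ n) - a *: t ^+ n = a *: t ^+ n * ((s t / t) ^+ n - 1))%R.
Proof.
rewrite linearZ rmorphXn /= mulrBr mulr1 -scalerAl expr_div_n mulrC divfK //.
by rewrite expf_neq0 ?uniformizer_neq0.
Qed.

(* In the expansion of [x] in powers of [t], [s] fixes the constant term and
   the other terms have positive valuation. *)
Lemma i_G_le_sub_unit x : vF x = 0 -> i_G vF t s + 1%:E <= vF (s x - x)%R.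
Proof.
have [a ->] := uniformizer_basis x => x0.
rewrite rmorph_sum -sumrB /=; apply: dval_sum_ge => i _.
have := dval_monomial_ge a i; rewrite x0 gal_monomial_sub => ai_ge0.
have [i0|i_gt0] := posnP i; first by rewrite i0 expr0 subrr mulr0 dval0 leey.
rewrite dvalM addeC; apply: leeD; last first.
  by rewrite i_G_sub1 dval_subX1_ge // -i_G_sub1 ltW ?i_G_gt0.
move: ai_ge0; rewrite dval_monomial; have := ltn_ord i.
move: (nat_of_ord i) i_gt0 => j j_gt0.
have := dvalNy vK (a i); case: (vK (a i)) => [r| |] // _ je; last first.
  have [+ _] := ramFK; rewrite -/e => /prednK <-.
  by rewrite enatmul_pinfty leey.
(* From [0 <= r * e + j] and [0 < j < e] follows [0 <= r], so the monomial has valuation at least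
   1. *)
rewrite -EFin_natmul !lee_fin -mulr_natr natz; have [r0|r0] := lerP 0%R r; nia.
Qed.

Lemma dval_gal_sub_nat p f (n : nat) : p \in [pchar residue_field vF] ->
  vF f = n%:Z%:E -> coprime n p -> vF (s f - f)%R = vF f + i_G vF t s.
Proof.
move=> pchar_p fn cop.
have tn0 : (t ^+ n != 0)%R by rewrite expf_neq0 ?uniformizer_neq0.
pose x := (f / t ^+ n)%R; have x0 : vF x = 0.
  by rewrite dvalM dvalV // fn dval_uniformizerX -EFinB subrr.
have sx_sub := i_G_le_sub_unit x0; have iG_ge1 := i_G_ge1.
(* That [s] preserves this valuation is read off from [s x - x] having positive valuation. *)
have sx0 : vF (s x) = 0.
  rewrite -[s x](subrK x) dvalD_ltr x0 //; apply: lt_le_trans sx_sub.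
  by rewrite adde_gt0 ?i_G_gt0.
have -> : (s f - f = t ^+ n * ((s x - x) + ((s t / t) ^+ n - 1) * s x))%R.
  have -> : f = (x * t ^+ n)%R by rewrite divfK.
  by rewrite rmorphM rmorphXn /= expr_div_n; field.
have vsX : vF (((s t / t) ^+ n - 1) * s x)%R = i_G vF t s.
  rewrite dvalM sx0 adde0 i_G_sub1 dval_subX1 ?(dval_nat_coprime pchar_p cop) //.
  by rewrite -i_G_sub1 i_G_gt0.
rewrite dvalM dval_uniformizerX fn; congr (_ + _).
case iGE : (i_G vF t s) iG_ge1 => [r| |] // _.
  rewrite dvalD_ltr vsX iGE //; apply: lt_le_trans sx_sub.
  by rewrite iGE lte_fin; lia.
(* Here [i_G] is [+oo]: neither summand dominates strictly, but both have infinite valuation. *)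
apply/eqP; rewrite -leye_eq; apply: le_trans (dvalD vF _ _).
by rewrite vsX iGE le_min lexx andbT; move: sx_sub; rewrite iGE.
Qed.

End TotallyRamified.

Theorem lemma6 (K : fieldType) (F : splittingFieldType K)
    (vK : discrete_valuation K) (vF : discrete_valuation F)
    (completeK : complete_valuation vK) (completeF : complete_valuation vF)
    (p : nat) (resK : p \in [pchar residue_field vK])
    (resF : p \in [pchar residue_field vF])
    (galFK : galois 1 {:F}) (ramFK : totally_ramified vK vF)
    (piF : F) (unifF : uniformizer vF piF)
    (s : gal_of {:F}) (sG1 : s \in ramification_group vF piF 1)
    (f : F) (fn0 : f != 0%R)
    (vf_n0 : vF f != 0) (vf_p : coprimez (fine (vF f)) p) :
  vF (s f - f)%R = vF f + i_G vF piF s.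
Proof.
have gal_sub_nat := dval_gal_sub_nat ramFK unifF sG1 resF.
have vfE := fineK (dval_fin_num vF fn0); move: vf_p vfE.
case: (fine _) => n cop /esym vfn; first exact: gal_sub_nat vfn _.
(* [Negz n] is -(n + 1), so the inverse has valuation [n.+1]; [coprimez] sees only absolute values,
   so [cop] still applies. *)
have g0 : (f^-1 != 0)%R by rewrite invr_eq0.
have vg : vF f^-1%R = n.+1%:Z%:E by rewrite dvalV // vfn.
have vsg := gal_sub_nat _ _ vg cop.
have sgE : vF (s f^-1%R) = vF f^-1%R.
  rewrite -[s _](subrK f^-1%R) dvalD_ltr // vsg lteDl ?dval_fin_num //.
  exact: (i_G_gt0 unifF sG1).
have vsf : vF (s f) = vF f.
  rewrite -[in LHS](invrK f) fmorphV dvalV ?fmorph_eq0 // sgE.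
  by rewrite dvalV // oppeK.
(* The factor [f * s f] contributes twice the valuation of [f], turning the leading [- vF f] into
   [vF f]. *)
have -> : (s f - f = - ((s f^-1 - f^-1) * (f * s f)))%R.
  by rewrite fmorphV; field; rewrite fmorph_eq0 fn0.
rewrite dvalN !dvalM vsg vg vsf vfn.
by have := i_G_gt0 unifF sG1; case: (i_G _ _ _) => [r| |] //= _; congr EFin; lia.
Qed.
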